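(* Let $(X,\varrho)$ be a complete metric space and let $U$ be an m-process on $X$. If $U$ is asymptotically compact, then there exists the minimal closed nonautonomous set that is pullback attracting for $U$; that is, a closed pullback attracting nonautonomous set $\{K(t):t\in\mathbb R\}$ such that $K(t)\subset C(t)$ for all $t\in\mathbb R$ whenever $\{C(t):t\in\mathbb R\}$ is a closed pullback attracting nonautonomous set.
   Context: $P(X)$ is the family of nonempty subsets of $X$, $\mathcal B(X)$ the family of nonempty bounded subsets of $X$, $\mathbb R_d=\{(s,t)\in\mathbb R^2: s\ge t\}$. For a point $y$ and sets $A,B\subset X$: $\mathrm{dist}(y,B)=\inf_{x\in B}\varrho(x,y)$ and $\mathrm{dist}(A,B)=\sup_{y\in A}\mathrm{dist}(y,B)$, with $\inf\emptyset=+\infty$. An m-process on $X$ is a map $U:\mathbb R_d\times X\to P(X)$, $(t,\tau,x)\mapsto U(t,\tau;x)$, such that (i) $U(t,t;x)=\{x\}$ for all $t\in\mathbb R$, $x\in X$; (ii) $U(t,\tau;x)\subset U(t,s;U(s,\tau;x))$ for all $t\ge s\ge\tau$, $x\in X$, where $U(t,s;A)=\bigcup_{y\in A}U(t,s;y)$. No continuity is assumed. A nonautonomous set is a family $\{K(t)\subset X:t\in\mathbb R\}$; it is closed if every $K(t)$ is closed. It is pullback attracting for $U$ if $\lim_{\tau\to-\infty}\mathrm{dist}(U(t,\tau;B),K(t))=0$ for every $t\in\mathbb R$ and every $B\in\mathcal B(X)$. $U$ is (pullback) asymptotically compact if for every $B\in\mathcal B(X)$, $t\in\mathbb R$ and any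 sequences $\tau_n\to-\infty$, $\xi_n\in U(t,\tau_n;B)$, the sequence $(\xi_n)$ has a subsequence converging in $X$. *)

(* Defs.v *)
From HB Require Import structures.
From mathcomp Require Import all_boot all_order all_algebra.
From mathcomp Require Import all_classical all_reals all_analysis.

Set Implicit Arguments.
Unset Strict Implicit.
Unset Printing Implicit Defensive.

Import Order.TTheory GRing.Theory Num.Theory.
Import numFieldNormedType.Exports.

Local Open Scope classical_set_scope.
Local Open Scope ring_scope.

(* The library's [completeType] is pointed; this predicate also covers the
   empty space. *)
Definition complete_metric (R : realType) (X : metricType R) : Prop :=
  forall u : nat -> X, cauchy (u @ \oo) -> exists l : X, u @ \oo --> l.

Definition metric_bounded (R : realType) (X : metricType R) (A : set X) : Prop :=
  exists M : R, forall x y, A x -> A y -> mdist x y <= M.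

(* The family B(X). *)
Definition nonempty_bounded (R : realType) (X : metricType R) (B : set X) : Prop :=
  B !=set0 /\ metric_bounded B.

(* Extended-real valued: [ereal_inf set0 = +oo]. *)
Definition dist_point (R : realType) (X : metricType R) (y : X) (B : set X) : \bar R :=
  ereal_inf [set (mdist x y)%:E | x in B].

(* The nonsymmetric Hausdorff semidistance. *)
Definition dist_set (R : realType) (X : metricType R) (A B : set X) : \bar R :=
  ereal_sup [set dist_point y B | y in A].

(* U(t, s; A) *)
Definition image_process (R : realType) (X : metricType R)
    (U : R -> R -> X -> set X) (t s : R) (A : set X) : set X :=
  \bigcup_(y in A) U t s y.

(* A map defined on pairs (t, tau) with t >= tau is represented by a total
   function; its values for t < tau are unconstrained and do not affect limits
   as tau --> -oo. *)
Definition m_process (R : realType) (X : metricType R)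
    (U : R -> R -> X -> set X) : Prop :=
  [/\ forall t tau x, tau <= t -> U t tau x !=set0,
      forall t x, U t t x = [set x] &
      forall t s tau x, tau <= s -> s <= t ->
        U t tau x `<=` image_process U t s (U s tau x)].

Definition closed_nonautonomous (R : realType) (X : metricType R)
    (K : R -> set X) : Prop :=
  forall t, closed (K t).

Definition pullback_attracting (R : realType) (X : metricType R)
    (U : R -> R -> X -> set X) (K : R -> set X) : Prop :=
  forall (t : R) (B : set X), nonempty_bounded B ->
    dist_set (image_process U t tau B) (K t) @[tau --> -oo%R] --> 0%E.

Definition asymptotically_compact (R : realType) (X : metricType R)
    (U : R -> R -> X -> set X) : Prop :=
  forall (B : set X) (t : R) (tau : nat -> R) (xi : nat -> X),
    nonempty_bounded B ->
    (forall n, tau n <= t) ->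
    tau @ \oo --> -oo%R ->
    (forall n, image_process U t (tau n) B (xi n)) ->
    exists phi : nat -> nat, increasing_seq phi /\
      exists l : X, (xi \o phi) @ \oo --> l.

(* Main.v *)
Require Import Defs.
From mathcomp Require Import all_boot all_order all_algebra.
From mathcomp Require Import all_classical all_reals all_analysis.

(** The minimal set is K(t) = the closure of the union of the pullback
    omega-limit sets omega(B, t), over all nonempty bounded B.

    It attracts because each omega(B, t) already attracts B
    ([omega_limit_attracts]): otherwise there would be points xi_n of
    U(t, tau_n; B), with tau_n --> -oo, staying at distance more than e from
    omega(B, t); asymptotic compactness makes a subsequence converge, and its
    limit belongs to omega(B, t), which is absurd.

    It is minimal because a closed set C attracting B at time t contains
    omega(B, t) ([omega_limit_sub]): a point of omega(B, t) is arbitrarily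
    close to points of U(t, tau; B) with tau arbitrarily negative, and those
    are arbitrarily close to C.  A closed set containing every omega(B, t)
    contains the closure of their union.

    Both halves use attraction in the e-s form of [pullback_attractingP]. *)

Set Implicit Arguments.
Unset Strict Implicit.
Unset Printing Implicit Defensive.

Import Order.TTheory GRing.Theory Num.Theory.
Import numFieldNormedType.Exports.

Local Open Scope classical_set_scope.
Local Open Scope ring_scope.

Lemma nonneg_cvge0P (R : realType) (T : Type) (F : set_system T)
    (FF : Filter F) (f : T -> \bar R) :
  (\forall t \near F, (0 <= f t)%E) ->
  f @ F --> 0%E <->
  forall e : R, 0 < e -> \forall t \near F, (f t <= e%:E)%E.
Proof.
move=> f_ge0; split=> [/fine_cvgP [f_fin f_cvg] e e_gt0 | f_le].
  near=> t.
  have ft_fin : f t \is a fin_num by near: t.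
  rewrite -(fineK ft_fin) lee_fin (le_trans (ler_norm _))// -normrN -sub0r.
  near: t.
  by move/cvgr_dist_le: f_cvg; apply.
have f_fin : \forall t \near F, f t \is a fin_num.
  have f_le1 := f_le 1 ltr01.
  near=> t.
  rewrite ge0_fin_numE; last by near: t.
  apply: (@le_lt_trans _ _ 1%:E); last exact: ltry.
  by near: t.
apply/fine_cvgP; split=> //.
apply/cvgrPdist_le => e e_gt0.
have f_lee := f_le e e_gt0.
near=> t.
have ft_fin : f t \is a fin_num by near: t.
have ft_ge0 : (0 <= f t)%E by near: t.
rewrite sub0r normrN /= ger0_norm ?fine_ge0// -lee_fin fineK//.
by near: t.
Unshelve. all: by end_near. Qed.

Lemma closure_mdistP (R : realType) (X : metricType R) (A : set X) (x : X) :
  closure A x <-> forall e : R, 0 < e -> exists2 y, A y & mdist x y < e.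
Proof.
split=> [Ax e e_gt0 | Ax V].
  have [y [Ay]] := Ax _ (nbhsx_ballx x e e_gt0).
  by rewrite ballEmdist => xy; exists y.
rewrite -nbhs_ballE => -[e e_gt0 /= eV].
have [y Ay xy] := Ax e e_gt0.
by exists y; split=> //; apply: eV; rewrite ballEmdist.
Qed.

Lemma dist_point_le_mdist (R : realType) (X : metricType R) (x y : X)
    (A : set X) : A x -> (dist_point y A <= (mdist x y)%:E)%E.
Proof. by move=> Ax; apply: ereal_inf_lbound; exists x. Qed.

Lemma dist_point_le_dist_set (R : realType) (X : metricType R) (y : X)
    (A B : set X) : A y -> (dist_point y B <= dist_set A B)%E.
Proof. by move=> Ay; apply: ereal_sup_ubound; exists y. Qed.

Lemma dist_set_ge0 (R : realType) (X : metricType R) (A B : set X) :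
  A !=set0 -> (0 <= dist_set A B)%E.
Proof.
move=> [y Ay]; apply: le_trans (dist_point_le_dist_set B Ay).
by apply: le_ereal_inf_tmp => _ [x _ <-]; rewrite lee_fin mdist_ge0.
Qed.

(** Nonemptiness of the values of U is needed to have a lower bound 0 on the
    semidistance: dist_set of an empty set is -oo, which does not tend to 0. *)
Lemma pullback_attractingP (R : realType) (X : metricType R)
    (U : R -> R -> X -> set X) (K : R -> set X) :
  (forall t tau x, tau <= t -> U t tau x !=set0) ->
  pullback_attracting U K <->
  forall t B, nonempty_bounded B -> forall e : R, 0 < e ->
    exists s : R, forall tau y, tau <= s -> image_process U t tau B y ->
      (dist_point y (K t) <= e%:E)%E.
Proof.
move=> U_neq0.
have dist_ge0 t B : nonempty_bounded B -> \forall tau \near (-oo)%R,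
    (0 <= dist_set (image_process U t tau B) (K t))%E.
  move=> [[x Bx] _]; exists t; split; first exact: num_real.
  move=> tau /ltW tau_le; apply: dist_set_ge0.
  by have [y Uy] := U_neq0 _ _ x tau_le; exists y, x.
split=> [attr t B bB e e_gt0 | attr t B bB].
  have /(nonneg_cvge0P _ (dist_ge0 t B bB)) := attr t B bB.
  move=> /(_ e e_gt0) [s [_ s_le]]; exists (s - 1) => tau y tau_le Uy.
  apply: le_trans (dist_point_le_dist_set _ Uy) _; apply: s_le.
  by rewrite (le_lt_trans tau_le)// ltrBlDr ltrDl.
apply/(nonneg_cvge0P _ (dist_ge0 t B bB)) => e e_gt0.
have [s s_le] := attr t B bB e e_gt0.
exists s; split; first exact: num_real.
move=> tau /ltW tau_le; apply: ge_ereal_sup => _ [y Uy <-].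
exact: s_le Uy.
Qed.

(** The intersection form makes closedness evident; [cvg_omega_limit] relates
    it to limits of sequences xi_n in U(t, tau_n; B) with tau_n --> -oo. *)
Definition omega_limit (R : realType) (X : metricType R)
    (U : R -> R -> X -> set X) (B : set X) (t : R) : set X :=
  \bigcap_s closure (\bigcup_(tau in [set tau | tau <= s])
                      image_process U t tau B).

Lemma cvg_omega_limit (R : realType) (X : metricType R)
    (U : R -> R -> X -> set X) (B : set X) (t : R)
    (tau : nat -> R) (xi : nat -> X) (l : X) :
  tau @ \oo --> -oo%R ->
  (forall n, image_process U t (tau n) B (xi n)) ->
  xi @ \oo --> l -> omega_limit U B t l.
Proof.
move=> tauNy Uxi xil s _; apply: closed_cvg xil; first exact: closed_closure.
have tau_le : \forall n \near \oo, tau n <= s by move/cvgrNyPle: tauNy; apply.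
near=> n; apply: subset_closure; exists (tau n) => //=.
by near: n.
Unshelve. all: by end_near. Qed.

Lemma increasing_seq_cvg (phi : nat -> nat) :
  increasing_seq phi -> phi @ \oo --> \oo.
Proof.
move=> phi_inc A [N _ NA]; exists N => // n /= Nn; apply: NA => /=.
apply: leq_trans Nn _; elim: n => // n IHn.
by apply: leq_ltn_trans IHn _; move/increasing_seqP: phi_inc; apply.
Qed.

(** By contradiction: points witnessing the failure along tau_n <= -n have, by
    asymptotic compactness, a limit point, and it lies in the omega-limit set
    from which they are supposed to stay away. *)
Lemma omega_limit_attracts (R : realType) (X : metricType R)
    (U : R -> R -> X -> set X) (B : set X) (t : R) :
  asymptotically_compact U -> nonempty_bounded B ->
  forall e : R, 0 < e ->
    exists s : R, forall tau y, tau <= s -> image_process U t tau B y ->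
      (dist_point y (omega_limit U B t) <= e%:E)%E.
Proof.
move=> acU bB e e_gt0; apply: contrapT => far.
(* Asymptotic compactness only concerns initial times tau_n <= t, hence the
   threshold min(t, -n). *)
have /choice [p pP] (n : nat) : exists p : R * X,
    [/\ p.1 <= t, p.1 <= - n%:R, image_process U t p.1 B p.2 &
        (e%:E < dist_point p.2 (omega_limit U B t))%E].
  apply: contrapT => no_p; apply: far; exists (Num.min t (- n%:R)) => tau y.
  rewrite le_min => /andP[tau_t tau_n] Uy; rewrite leNgt; apply/negP => e_lt.
  by apply: no_p; exists (tau, y).
pose tau n := (p n).1; pose xi n := (p n).2.
have tauNy : tau @ \oo --> -oo%R.
  apply/cvgrNyPle => A; near=> n.
  have [_ tau_n _ _] := pP n; apply: le_trans tau_n _.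
  rewrite lerNl; near: n; exact: nbhs_infty_ger.
have Uxi n : image_process U t (tau n) B (xi n) by have [] := pP n.
have [|phi [phi_inc [l xil]]] := acU B t tau xi bB _ tauNy Uxi.
  by move=> n; have [] := pP n.
have omega_l : omega_limit U B t l.
  apply: cvg_omega_limit xil => [|n]; last exact: Uxi.
  exact: (cvg_comp _ _ (increasing_seq_cvg phi_inc) tauNy).
have [N _ /(_ N (leqnn N))] := metricType_numDomainType.cvgr_dist_lt xil e_gt0.
have [_ _ _] := pP (phi N); rewrite ltNge => /negP far_xi xil_lt.
apply: far_xi; apply: le_trans (dist_point_le_mdist _ omega_l) _.
by rewrite lee_fin ltW.
Unshelve. all: by end_near. Qed.

(** A point x of the omega-limit set is near some y in U(t, tau; B) with tau as
    negative as desired, and y is near C; since C is closed, x lies in C. *)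
Lemma omega_limit_sub (R : realType) (X : metricType R)
    (U : R -> R -> X -> set X) (B : set X) (t : R) (C : set X) :
  closed C ->
  (forall e : R, 0 < e ->
    exists s : R, forall tau y, tau <= s -> image_process U t tau B y ->
      (dist_point y C <= e%:E)%E) ->
  omega_limit U B t `<=` C.
Proof.
move=> clC attrC x omega_x; apply: clC; apply/closure_mdistP => e e_gt0.
have e2_gt0 : 0 < e / 2 by rewrite divr_gt0.
(* A distance to C at most e/4, thus less than e/2, is realized up to e/2 by a
   point of C even though the infimum may not be attained. *)
have e4_gt0 : 0 < e / 2 / 2 by rewrite divr_gt0.
have [s s_le] := attrC _ e4_gt0.
have /closure_mdistP /(_ _ e2_gt0) [y [tau /= tau_le Uy] xy] := omega_x s I.
have : (dist_point y C < (e / 2)%:E)%E.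
  apply: le_lt_trans (s_le _ _ tau_le Uy) _.
  by rewrite lte_fin ltr_pdivrMr// ltr_pMr// ltr1n.
move=> /ereal_inf_lt [_ [c Cc <-]]; rewrite lte_fin metric_sym => yc.
exists c => //; apply: le_lt_trans (metric_triangle x y c) _.
by rewrite (splitr e) ltrD.
Qed.

Unset Implicit Arguments.

Theorem theorem2p14 (R : realType) (X : metricType R)
    (U : R -> R -> X -> set X) :
  complete_metric X ->
  m_process U ->
  asymptotically_compact U ->
  exists K : R -> set X,
    [/\ closed_nonautonomous K,
        pullback_attracting U K &
        forall C : R -> set X,
          closed_nonautonomous C -> pullback_attracting U C ->
          forall t : R, K t `<=` C t].
Proof.
move=> _ [U_neq0 _ _] acU.
exists (fun t =>
  closure (\bigcup_(B in nonempty_bounded (X := X)) omega_limit U B t)).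
split=> [t||C clC attrC t].
- exact: closed_closure.
- apply/pullback_attractingP => // t B bB e e_gt0.
  have [s s_le] := omega_limit_attracts t acU bB e_gt0.
  exists s => tau y tau_le Uy; apply: le_trans (s_le _ _ tau_le Uy).
  apply: ereal_inf_le_tmp; apply: image_subset => x omega_x.
  by apply: subset_closure; exists B.
- rewrite closureE => x; apply; split; first exact: clC.
  apply: bigcup_sub => B bB; apply: omega_limit_sub; first exact: clC.
  by move/pullback_attractingP: attrC; apply.
Qed.
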